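(* Let $f:\mathbb{R}^d\to\mathbb{R}^d$ be sufficiently differentiable (at least twice continuously differentiable), let $C:\mathbb{R}^d\to\mathbb{R}$ be twice differentiable, and let $\theta,\gamma\in\mathbb{R}^d$, a step size $h>0$, and integers $N\ge 1$, $s\ge 1$ be given. Let $a_{ij}$, $b_i$ ($i,j=1,\dots,s$) be real coefficients of an $s$-stage Runge--Kutta method with $b_i\neq 0$ for all $i$. Let $y_n=y_n(\theta,\gamma)=[x_n(\theta)^\top,\delta_n(\theta,\gamma)^\top]^\top\in\mathbb{R}^{2d}$, $n=0,\dots,N$, be the numerical solution obtained by applying this method with step size $h$ to $$\frac{\mathrm{d}}{\mathrm{d}t}y=g(y),\qquad y=\begin{bmatrix}x\\ \delta\end{bmatrix},\qquad g(y)=\begin{bmatrix} f(x)\\ \nabla_x f(x)\,\delta\end{bmatrix},\qquad y(0)=\begin{bmatrix}\theta\\ \gamma\end{bmatrix},$$ that is, $y_0=[\theta^\top,\gamma^\top]^\top$ and, for $n=0,\dots,N-1$, $$y_{n+1}=y_n+h\sum_{i=1}^s b_i p_{n,i},\qquad p_{n,i}=g(Y_{n,i}),\qquad Y_{n,i}=y_n+h\sum_{j=1}^s a_{ij}p_{n,j}\qquad(i=1,\dots,s).$$ Assume that real coefficients $A_{ij}$, $B_i$ ($i,j=1,\dots,s$) satisfy $$b_i=B_i\quad(i=1,\dots,s),\qquad b_iA_{ij}+B_ja_{ji}=b_iB_j\quad(i,j=1,\dots,s).$$ Let $\phi_n=[\xi_n^\top,\lambda_n^\top]^\top\in\mathbb{R}^{2d}$,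 $n=0,\dots,N$, be the solution of the Runge--Kutta discretization, with coefficients $A_{ij},B_i$, of the coupled adjoint system $\frac{\mathrm{d}}{\mathrm{d}t}\phi=-\nabla_y g(y)^\top\phi$, that is, for $n=0,\dots,N-1$, $$\phi_{n+1}=\phi_n+h\sum_{i=1}^s B_i q_{n,i},\qquad q_{n,i}=-\nabla_y g(Y_{n,i})^\top\Phi_{n,i},\qquad \Phi_{n,i}=\phi_n+h\sum_{j=1}^s A_{ij}q_{n,j}\qquad(i=1,\dots,s),$$ with the final state $$\xi_N=\bigl(\mathsf{H}_xC(x_N(\theta))\bigr)\,\delta_N(\theta,\gamma),\qquad \lambda_N=\nabla_xC(x_N(\theta)).$$ Then $$\xi_0=\bigl(\mathsf{H}_\theta C(x_N(\theta))\bigr)\gamma\qquad\text{and}\qquad \lambda_0=\nabla_\theta C(x_N(\theta)).$$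
   Context: Notation. For a vector-valued map $F$, $\nabla_xF(x)$ denotes its Jacobian matrix. For the scalar function $C$, $\nabla_xC(x_N(\theta))$ and $\mathsf{H}_xC(x_N(\theta))$ denote the gradient (a column vector) and Hessian matrix of $C$ as a function of its argument $x$, evaluated at $x=x_N(\theta)$. By contrast, $\nabla_\theta C(x_N(\theta))$ and $\mathsf{H}_\theta C(x_N(\theta))$ denote the gradient and Hessian, with respect to $\theta$, of the composite function $\theta\mapsto C(x_N(\theta))$. The first component $x_n(\theta)$ of $y_n$ depends only on $\theta$ and is the numerical solution of $\frac{\mathrm{d}}{\mathrm{d}t}x=f(x)$, $x(0)=\theta$, given by the Runge--Kutta method with coefficients $a_{ij},b_i$. The Jacobian of $g$ is the $2d\times 2d$ block matrix $$\nabla_yg(y)=\begin{bmatrix}\nabla_xf(x)&0\\ \nabla_x(\nabla_xf(x)\delta)&\nabla_xf(x)\end{bmatrix},$$ where $\nabla_x(\nabla_xf(x)\delta)$ is the Jacobian with respect to $x$ of $x\mapsto\nabla_xf(x)\delta$ for fixed $\delta$, i.e. its $(i,k)$ entry is $\sum_{j=1}^d\frac{\partial^2f_i}{\partial x_j\partial x_k}(x)\,\delta_j$. The vectors $Y_{n,i}\in\mathbb{R}^{2d}$ used in the adjoint scheme are the same stage vectors as those of the forward scheme. Convention (relevant to implicit methods, which are allowed). The numerical solution is understood to be well defined: for all initial data $(\theta',\gamma')$ with $\theta'$ in a neighbourhood of $\theta$ and $\gamma'\in\mathbb{R}^d$, the stage equations of the forward scheme have a unique solution at each of the $N$ steps,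 and the stages $Y_{n,i}$ and the vectors $y_n$ are sufficiently differentiable functions of $(\theta',\gamma')$ (at least twice continuously differentiable for the $x$-components and once for the $\delta$-components). The adjoint scheme is solved backwards from $n=N$ to $n=0$; the conclusion concerns any $\phi_n$, $\Phi_{n,i}$ satisfying its equations with the stated final state. *)

(* Defs.v *)
From HB Require Import structures.
From mathcomp Require Import all_boot all_order all_algebra.
From mathcomp Require Import all_classical all_reals all_analysis.
Set Implicit Arguments.
Unset Strict Implicit.
Unset Printing Implicit Defensive.
Import Order.TTheory GRing.Theory Num.Theory.
Import numFieldNormedType.Exports.
Local Open Scope classical_set_scope.
Local Open Scope ring_scope.

(* Vectors of R^d are columns ['cV[R]_d]. *)

Definition partial (R : realType) (n : nat) (W : normedModType R)
    (j : 'I_n) (F : 'cV[R]_n -> W) (x : 'cV[R]_n) : W :=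
  'D_(delta_mx j 0) F x.

(* The library's ['J] acts on row vectors and is the transpose of this. *)
Definition jac (R : realType) (n m : nat) (F : 'cV[R]_n -> 'cV[R]_m)
    (x : 'cV[R]_n) : 'M[R]_(m, n) :=
  \matrix_(i < m, j < n) partial j (fun z => F z i 0) x.

Definition grad (R : realType) (n : nat) (C : 'cV[R]_n -> R) (x : 'cV[R]_n) :
    'cV[R]_n :=
  \col_(i < n) partial i C x.

Definition hess (R : realType) (n : nat) (C : 'cV[R]_n -> R) (x : 'cV[R]_n) :
    'M[R]_n :=
  \matrix_(i < n, j < n) partial i (partial j C) x.

(* Class C^k on U, meant for open U. Differentiability is in the sense of
   Frechet. *)
Fixpoint class_C (R : realType) (n : nat) (W : normedModType R) (k : nat)
    (U : set 'cV[R]_n) (F : 'cV[R]_n -> W) {struct k} : Prop :=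
  match k with
  | 0 => forall x, U x -> {for x, continuous F}
  | k'.+1 => (forall x, U x -> differentiable F x) /\
             (forall j, class_C k' U (partial j F))
  end.

Definition twice_differentiable (R : realType) (n : nat) (C : 'cV[R]_n -> R) :
    Prop :=
  (forall x, differentiable C x) /\
  (forall j x, differentiable (partial j C) x).

Definition variational (R : realType) (d : nat) (f : 'cV[R]_d -> 'cV[R]_d)
    (y : 'cV[R]_(d + d)) : 'cV[R]_(d + d) :=
  col_mx (f (usubmx y)) (jac f (usubmx y) *m dsubmx y).

(* The vector field [F] may depend on the stage: the adjoint system is
   non-autonomous, its i-th stage using the i-th forward stage. *)
Definition rk_stages (R : realType) (m s : nat) (h : R) (a : 'I_s -> 'I_s -> R)
    (F : 'I_s -> 'cV[R]_m -> 'cV[R]_m) (u : 'cV[R]_m)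
    (V : 'I_s -> 'cV[R]_m) : Prop :=
  forall i, V i = u + h *: \sum_(j < s) a i j *: F j (V j).

Definition rk_update (R : realType) (m s : nat) (h : R) (b : 'I_s -> R)
    (F : 'I_s -> 'cV[R]_m -> 'cV[R]_m) (u : 'cV[R]_m)
    (V : 'I_s -> 'cV[R]_m) (u' : 'cV[R]_m) : Prop :=
  u' = u + h *: \sum_(i < s) b i *: F i (V i).

(* [y n z] and [Y n i z] are the N-step approximations and stages for the
   autonomous field [g] started at [z]. *)
Definition rk_solution (R : realType) (m s N : nat) (h : R)
    (a : 'I_s -> 'I_s -> R) (b : 'I_s -> R) (g : 'cV[R]_m -> 'cV[R]_m)
    (y : nat -> 'cV[R]_m -> 'cV[R]_m)
    (Y : nat -> 'I_s -> 'cV[R]_m -> 'cV[R]_m) (z : 'cV[R]_m) : Prop :=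
  y 0%N z = z /\
  forall n, (n < N)%N ->
    rk_stages h a (fun=> g) (y n z) (fun i => Y n i z) /\
    rk_update h b (fun=> g) (y n z) (fun i => Y n i z) (y n.+1 z).

Definition unique_stages (R : realType) (m s N : nat) (h : R)
    (a : 'I_s -> 'I_s -> R) (g : 'cV[R]_m -> 'cV[R]_m)
    (y : nat -> 'cV[R]_m -> 'cV[R]_m)
    (Y : nat -> 'I_s -> 'cV[R]_m -> 'cV[R]_m) (z : 'cV[R]_m) : Prop :=
  forall n, (n < N)%N -> forall V : 'I_s -> 'cV[R]_m,
    rk_stages h a (fun=> g) (y n z) V -> forall i, V i = Y n i z.

(* The x-block (upper) is C^2 and the delta-block (lower) is C^1. *)
Definition smooth_blocks (R : realType) (d : nat) (D : set 'cV[R]_(d + d))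
    (F : 'cV[R]_(d + d) -> 'cV[R]_(d + d)) : Prop :=
  class_C 2 D (fun z => usubmx (F z)) /\ class_C 1 D (fun z => dsubmx (F z)).

(* The numerical solution of the variational system is well defined for all
   initial data in U x R^d. *)
Definition well_defined (R : realType) (d s N : nat) (h : R)
    (a : 'I_s -> 'I_s -> R) (b : 'I_s -> R) (f : 'cV[R]_d -> 'cV[R]_d)
    (y : nat -> 'cV[R]_(d + d) -> 'cV[R]_(d + d))
    (Y : nat -> 'I_s -> 'cV[R]_(d + d) -> 'cV[R]_(d + d))
    (U : set 'cV[R]_d) : Prop :=
  let D := [set z : 'cV[R]_(d + d) | U (usubmx z)] in
  [/\ forall z, D z -> rk_solution N h a b (variational f) y Y z,
      forall z, D z -> unique_stages N h a (variational f) y Y z,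
      forall n, (n <= N)%N -> smooth_blocks D (y n)
    & forall n i, (n < N)%N -> smooth_blocks D (Y n i)].

(* Runge-Kutta discretization of phi' = - (jac g)^T phi along given stages Y. *)
Definition adjoint_solution (R : realType) (m s N : nat) (h : R)
    (A : 'I_s -> 'I_s -> R) (B : 'I_s -> R) (g : 'cV[R]_m -> 'cV[R]_m)
    (Y : nat -> 'I_s -> 'cV[R]_m) (phi : nat -> 'cV[R]_m)
    (Phi : nat -> 'I_s -> 'cV[R]_m) : Prop :=
  forall n, (n < N)%N ->
    let q := fun (i : 'I_s) (p : 'cV[R]_m) => - ((jac g (Y n i))^T *m p) in
    rk_stages h A q (phi n) (Phi n) /\
    rk_update h B q (phi n) (Phi n) (phi n.+1).

(* Main.v *)
Require Import Defs.
From mathcomp Require Import all_boot all_order all_algebra ring.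
From mathcomp Require Import all_classical all_reals all_analysis.
Import Order.TTheory GRing.Theory Num.Theory.
Import numFieldNormedType.Exports.
Local Open Scope classical_set_scope.
Local Open Scope ring_scope.

Set Implicit Arguments.
Unset Strict Implicit.

(** Write z = (theta, gamma), let y_n be the n-step numerical flow of the
    variational system, and let G (x, delta) = grad C (x) . delta
    ([tangent_cost]).  Two facts combine.

    First, the adjoint scheme transports gradients backwards exactly.  The
    derivative u_n of y_n in a direction v solves the Runge-Kutta scheme
    linearized along the stages, because differentiating the stage equations
    gives the stage equations of the linearized field ([rk_stages_derive],
    [rk_update_derive]).  The conditions on the two sets of coefficients are
    those under which a partitioned Runge-Kutta method preserves bilinear
    invariants, so phi_n . u_n does not depend on n ([rk_bilinear_invariant]).
    The final state is the gradient of G at y_N: its two blocks are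
    hess C (x_N) *m delta_N and grad C (x_N) ([derive_tangent_cost]).  Hence
    phi_0 . v = phi_N . u_N is the derivative of G \o y_N at z in the
    direction v, that is, phi_0 is the gradient of G \o y_N at z.

    Second, discretization commutes with linearization: delta_n is the
    derivative of x_n in the direction gamma ([derive_usubmx_flow]).
    Differentiating the x-stages in that direction produces vectors that solve
    the same equations as the delta-stages, and the stage equations have only
    one solution.  By the chain rule, G (y_N (theta, gamma)) is the derivative
    of theta |-> C (x_N (theta)) in the direction gamma, which equals
    grad c (theta) . gamma with c = C \o x_N ([tangent_cost_flow]).

    It remains to read off the two blocks of the gradient of
    (theta, gamma) |-> grad c (theta) . gamma: the theta-block is
    hess c (theta) *m gamma and the gamma-block is grad c (theta). *)

(** * Differential calculus on column vectors *)

Lemma differentiable_sumr (R : realType) (V W : normedModType R) (n : nat)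
    (F : 'I_n -> V -> W) (z : V) :
  (forall i, differentiable (F i) z) ->
  differentiable (fun t => \sum_(i < n) F i t) z.
Proof. by move=> dF; rewrite -fct_sumE; exact: differentiable_sum. Qed.

Lemma derive_sumr (R : realType) (V W : normedModType R) (n : nat)
    (F : 'I_n -> V -> W) (z v : V) :
  (forall i, differentiable (F i) z) ->
  'D_v (fun t => \sum_(i < n) F i t) z = \sum_(i < n) 'D_v (F i) z.
Proof.
move=> dF; rewrite -fct_sumE derive_sum // => i; exact: diff_derivable.
Qed.

Lemma differentiable_mx (R : realType) (V : normedModType R) (m n : nat)
    (F : V -> 'M[R]_(m, n)) (z : V) :
  (forall i j, differentiable (fun t => F t i j : R) z) -> differentiable F z.
Proof.
move=> dF.
rewrite (_ : F = fun t => \sum_(i < m) \sum_(j < n) F t i j *: delta_mx i j);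
  last by apply/funext => t; rewrite -matrix_sum_delta.
by do 2!apply: differentiable_sumr => ?; exact: differentiableZl.
Qed.

Lemma differentiable_entry (R : realType) (V : normedModType R) (m n : nat)
    (F : V -> 'M[R]_(m, n)) (z : V) (i : 'I_m) (j : 'I_n) :
  differentiable F z -> differentiable (fun t => F t i j : R) z.
Proof.
move=> dF; apply: (@differentiable_comp _ _ _ _ F (fun M => M i j : R)) => //.
exact: differentiable_coord.
Qed.

Lemma derive_entry (R : realType) (V : normedModType R) (m n : nat)
    (F : V -> 'M[R]_(m, n)) (z v : V) (i : 'I_m) (j : 'I_n) :
  differentiable F z -> 'D_v (fun t => F t i j : R) z = ('D_v F z) i j.
Proof. by move=> dF; rewrite derive_mx ?mxE //; exact: diff_derivable. Qed.

Lemma differentiable_usubmx (R : realType) (V : normedModType R) (m n : nat)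
    (F : V -> 'cV[R]_(m + n)) (z : V) :
  differentiable F z -> differentiable (fun t => usubmx (F t)) z.
Proof.
move=> dF; apply: differentiable_mx => i j.
under eq_fun do rewrite mxE.
exact: differentiable_entry.
Qed.

Lemma differentiable_dsubmx (R : realType) (V : normedModType R) (m n : nat)
    (F : V -> 'cV[R]_(m + n)) (z : V) :
  differentiable F z -> differentiable (fun t => dsubmx (F t)) z.
Proof.
move=> dF; apply: differentiable_mx => i j.
under eq_fun do rewrite mxE.
exact: differentiable_entry.
Qed.

Lemma differentiable_col_mx (R : realType) (V : normedModType R) (m n : nat)
    (F : V -> 'cV[R]_m) (G : V -> 'cV[R]_n) (z : V) :
  differentiable F z -> differentiable G z ->
  differentiable (fun t => col_mx (F t) (G t)) z.
Proof.
move=> dF dG; apply: differentiable_mx => i j.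
under eq_fun do rewrite mxE.
by case: (fintype.split i) => k; exact: differentiable_entry.
Qed.

Lemma derive_usubmx (R : realType) (V : normedModType R) (m n : nat)
    (F : V -> 'cV[R]_(m + n)) (z v : V) :
  differentiable F z -> 'D_v (fun t => usubmx (F t)) z = usubmx ('D_v F z).
Proof.
move=> dF; apply/colP => i; rewrite mxE -!derive_entry //.
  by congr ('D_v _ z); apply/funext => t; rewrite mxE.
exact: differentiable_usubmx.
Qed.

Lemma derive_dsubmx (R : realType) (V : normedModType R) (m n : nat)
    (F : V -> 'cV[R]_(m + n)) (z v : V) :
  differentiable F z -> 'D_v (fun t => dsubmx (F t)) z = dsubmx ('D_v F z).
Proof.
move=> dF; apply/colP => i; rewrite mxE -!derive_entry //.
  by congr ('D_v _ z); apply/funext => t; rewrite mxE.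
exact: differentiable_dsubmx.
Qed.

Lemma derive_chain (R : realType) (U V W : normedModType R) (F : U -> V)
    (G : V -> W) (z v : U) :
  differentiable F z -> differentiable G (F z) ->
  'D_v (fun t => G (F t)) z = 'D_('D_v F z) G (F z).
Proof.
move=> dF dG; rewrite !deriveE //; last first.
  exact: (@differentiable_comp _ _ _ _ F G).
by rewrite (diff_comp dF dG).
Qed.

Lemma derive_sum_partial (R : realType) (n : nat) (W : normedModType R)
    (F : 'cV[R]_n -> W) (x v : 'cV[R]_n) :
  differentiable F x -> 'D_v F x = \sum_(j < n) v j 0 *: partial j F x.
Proof.
move=> dF; rewrite deriveE // [in LHS](matrix_sum_delta v) linear_sum.
apply: eq_bigr => j _.
by rewrite big_ord1 linearZ /partial deriveE.
Qed.

Lemma jac_mulmx (R : realType) (n m : nat) (F : 'cV[R]_n -> 'cV[R]_m)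
    (x v : 'cV[R]_n) :
  differentiable F x -> jac F x *m v = 'D_v F x.
Proof.
move=> dF; apply/colP => i; rewrite mxE -derive_entry //.
rewrite derive_sum_partial; last exact: differentiable_entry.
by apply: eq_bigr => j _; rewrite mxE mulrC.
Qed.

(** Both sides are limits of one and the same difference quotient. *)
Lemma derive_slice_usubmx (R : realType) (m n : nat) (W : normedModType R)
    (F : 'cV[R]_(m + n) -> W) (x v : 'cV[R]_m) (w : 'cV[R]_n) :
  'D_(col_mx v 0) F (col_mx x w) = 'D_v (fun t => F (col_mx t w)) x.
Proof.
by rewrite /derive; under eq_fun do
  rewrite /= scale_col_mx add_col_mx scaler0 add0r.
Qed.

Lemma derive_slice_dsubmx (R : realType) (m n : nat) (W : normedModType R)
    (F : 'cV[R]_(m + n) -> W) (x : 'cV[R]_m) (w v : 'cV[R]_n) :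
  'D_(col_mx 0 v) F (col_mx x w) = 'D_v (fun t => F (col_mx x t)) w.
Proof.
by rewrite /derive; under eq_fun do
  rewrite /= scale_col_mx add_col_mx scaler0 add0r.
Qed.

(** * The Euclidean inner product *)

Definition dot (R : realType) (n : nat) (p u : 'cV[R]_n) : R :=
  (p^T *m u) 0 0.

Lemma dotC (R : realType) (n : nat) (p u : 'cV[R]_n) : dot p u = dot u p.
Proof. by rewrite /dot -[in LHS](trmxK (p^T *m u)) mxE trmx_mul trmxK. Qed.

Lemma dotNl (R : realType) (n : nat) (p u : 'cV[R]_n) :
  dot (- p) u = - dot p u.
Proof. by rewrite /dot linearN mulNmx [LHS]mxE. Qed.

Lemma dot_mulmxr (R : realType) (m n : nat) (J : 'M[R]_(m, n)) (p : 'cV[R]_m)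
    (u : 'cV[R]_n) : dot p (J *m u) = dot (J^T *m p) u.
Proof. by rewrite /dot trmx_mul trmxK mulmxA. Qed.

Lemma dot_increment (R : realType) (n s : nat) (p u : 'cV[R]_n) (h : R)
    (c : 'I_s -> R) (v : 'I_s -> 'cV[R]_n) :
  dot p (u + h *: \sum_(j < s) c j *: v j) =
  dot p u + h * \sum_(j < s) c j * dot p (v j).
Proof.
rewrite /dot mulmxDr -scalemxAr mulmx_sumr [LHS]mxE; congr (_ + _).
rewrite [LHS]mxE summxE; congr (_ * _).
by apply: eq_bigr => j _; rewrite -scalemxAr [LHS]mxE.
Qed.

Lemma dot_delta (R : realType) (n : nat) (p : 'cV[R]_n) (i : 'I_n) :
  dot p (delta_mx i 0) = p i 0.
Proof. by rewrite /dot -colE !mxE. Qed.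

Lemma dot_grad (R : realType) (n : nat) (C : 'cV[R]_n -> R) (x v : 'cV[R]_n) :
  differentiable C x -> dot (grad C x) v = 'D_v C x.
Proof.
move=> dC; rewrite /dot mxE derive_sum_partial //.
by apply: eq_bigr => j _; rewrite !mxE mulrC.
Qed.

Lemma derive_dot (R : realType) (n : nat) (p t v : 'cV[R]_n) :
  'D_v (dot p) t = dot p v.
Proof.
have dt j : differentiable (fun t : 'cV[R]_n => t j 0 : R) t.
  exact: (@differentiable_entry _ _ _ _ id).
have -> : dot p = fun t => \sum_j p j 0 *: (t j 0 : R).
  by apply/funext => w; rewrite /dot mxE; apply: eq_bigr => j _; rewrite mxE.
rewrite derive_sumr; last by move=> j; exact: differentiableZ.
apply: eq_bigr => j _; rewrite deriveZ; last exact: diff_derivable.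
by rewrite (@derive_entry _ _ _ _ id) // derive_id.
Qed.

(** * Linearization and bilinear invariants of Runge-Kutta schemes *)

Lemma derive_rk_increment (R : realType) (V W : normedModType R) (s : nat)
    (h : R) (c : 'I_s -> R) (u : V -> W) (F : 'I_s -> V -> W) (z v : V) :
  differentiable u z -> (forall j, differentiable (F j) z) ->
  'D_v (fun t => u t + h *: \sum_(j < s) c j *: F j t) z =
  'D_v u z + h *: \sum_(j < s) c j *: 'D_v (F j) z.
Proof.
move=> du dF.
have dcF j : differentiable (fun t => c j *: F j t) z.
  exact: differentiableZ.
have dS : differentiable (fun t => \sum_(j < s) c j *: F j t) z.
  exact: differentiable_sumr.
rewrite deriveD; last 2 first.
- exact: diff_derivable.
- by apply: diff_derivable; exact: differentiableZ.
congr (_ + _).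
rewrite deriveZ; last exact: diff_derivable.
rewrite derive_sumr //; congr (_ *: _); apply: eq_bigr => j _.
by rewrite deriveZ //; exact: diff_derivable.
Qed.

(** Since each stage equation holds near [z], both of its sides have the same
    derivative at [z]: the derivatives of the stages are stages of the
    linearized scheme. *)
Lemma rk_stages_derive (R : realType) (V : normedModType R) (m s : nat) (h : R)
    (a : 'I_s -> 'I_s -> R) (g : 'cV[R]_m -> 'cV[R]_m)
    (u : V -> 'cV[R]_m) (K : 'I_s -> V -> 'cV[R]_m) (z v : V) :
  (\near z, rk_stages h a (fun=> g) (u z) (K ^~ z)) ->
  differentiable u z -> (forall i, differentiable (K i) z) ->
  (forall i, differentiable g (K i z)) ->
  rk_stages h a (fun i w => jac g (K i z) *m w)
    ('D_v u z) (fun i => 'D_v (K i) z).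
Proof.
move=> st du dK dg i.
rewrite (@near_eq_derive _ _ _ _
  (fun t => u t + h *: \sum_(j < s) a i j *: g (K j t))); last first.
  by apply: filterS st => t; apply.
rewrite derive_rk_increment //; last first.
  by move=> j; exact: (@differentiable_comp _ _ _ _ (K j) g).
congr (_ + _ *: _); apply: eq_bigr => j _.
by rewrite derive_chain // -jac_mulmx.
Qed.

Lemma rk_update_derive (R : realType) (V : normedModType R) (m s : nat) (h : R)
    (b : 'I_s -> R) (g : 'cV[R]_m -> 'cV[R]_m)
    (u u' : V -> 'cV[R]_m) (K : 'I_s -> V -> 'cV[R]_m) (z v : V) :
  (\near z, rk_update h b (fun=> g) (u z) (K ^~ z) (u' z)) ->
  differentiable u z -> (forall i, differentiable (K i) z) ->
  (forall i, differentiable g (K i z)) ->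
  rk_update h b (fun i w => jac g (K i z) *m w)
    ('D_v u z) (fun i => 'D_v (K i) z) ('D_v u' z).
Proof.
move=> up du dK dg; rewrite /rk_update.
rewrite (near_eq_derive v up).
rewrite derive_rk_increment //; last first.
  by move=> j; exact: (@differentiable_comp _ _ _ _ (K j) g).
congr (_ + _ *: _); apply: eq_bigr => j _.
by rewrite derive_chain // -jac_mulmx.
Qed.

(** Expanding [dot p' u'], the terms of order h cancel because the fields
    [J i] and [- (J i)^T] are dual, so that d/dt (phi . u) = 0 at each stage:
    [dot (P i) (J i *m K i)] and [dot (- ((J i)^T *m P i)) (K i)] are opposite.
    Replacing the stages by the states in these identities leaves terms of
    order h ^ 2, which cancel by the relation between the coefficients. *)
Lemma rk_bilinear_invariant (R : realType) (m s : nat) (h : R)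
    (a A : 'I_s -> 'I_s -> R) (b B : 'I_s -> R) (J : 'I_s -> 'M[R]_m)
    (u u' p p' : 'cV[R]_m) (K P : 'I_s -> 'cV[R]_m) :
  (forall i, b i = B i) ->
  (forall i j, b i * A i j + B j * a j i = b i * B j) ->
  rk_stages h a (fun i w => J i *m w) u K ->
  rk_update h b (fun i w => J i *m w) u K u' ->
  rk_stages h A (fun i w => - ((J i)^T *m w)) p P ->
  rk_update h B (fun i w => - ((J i)^T *m w)) p P p' ->
  dot p' u' = dot p u.
Proof.
move=> bB abAB stK upK stP upP.
(* k and q are the increments of the two schemes; the duality of J i and
   - (J i)^T enters through qK alone. *)
pose k i := J i *m K i; pose q i := - ((J i)^T *m P i).
pose D i j := dot (q i) (k j); pose E i := dot (P i) (k i).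
have qK i : dot (q i) (K i) = - E i by rewrite dotNl -dot_mulmxr.
have qu i : dot (q i) u = - E i - h * \sum_j a i j * D i j.
  by rewrite -qK [in RHS](stK i) dot_increment addrK.
have pk i : dot p (k i) = E i - h * \sum_j A i j * D j i.
  rewrite /E [in RHS](stP i) [dot (_ + _) _]dotC dot_increment dotC.
  under [X in _ + h * X - _]eq_bigr do rewrite dotC.
  by rewrite addrK.
(* Multiplied by D i j and summed, the relation between the coefficients
   balances the terms of order h ^ 2. *)
have key : \sum_i B i * (\sum_j b j * D i j) =
    \sum_i b i * (\sum_j A i j * D j i) + \sum_i B i * (\sum_j a i j * D i j).
  under eq_bigr do rewrite mulr_sumr.
  under [X in _ = X + _]eq_bigr do rewrite mulr_sumr.
  under [X in _ = _ + X]eq_bigr do rewrite mulr_sumr.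
  rewrite [X in _ = X + _]exchange_big /= -big_split /=; apply: eq_bigr => i _.
  rewrite -big_split /=; apply: eq_bigr => j _.
  by rewrite !mulrA -mulrDl abAB [B i * _]mulrC.
have sumB (w x y : 'I_s -> R) :
    \sum_i w i * (x i - h * y i) = \sum_i w i * x i - h * \sum_i w i * y i.
  rewrite mulr_sumr -sumrB; apply: eq_bigr => i _; ring.
have pu' : dot p u' =
    dot p u + h * \sum_i b i * (E i - h * \sum_j A i j * D j i).
  by rewrite upK dot_increment; under eq_bigr do rewrite pk.
have qu' i : dot (q i) u' =
    - E i - h * (\sum_j a i j * D i j - \sum_j b j * D i j).
  rewrite upK dot_increment qu; ring.
rewrite upP dotC dot_increment dotC pu'.
under [X in _ + h * X]eq_bigr do rewrite dotC qu'.
rewrite !sumB.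
under [X in _ + h * (_ - h * X) = _]eq_bigr do rewrite mulrBr.
rewrite sumrB key.
under [X in _ + h * (X - _) = _]eq_bigr do rewrite mulrN -bB.
rewrite sumrN; ring.
Qed.

(** * The variational field and the gradient of the final cost *)

Lemma usubmx_increment (R : realType) (m n s : nat) (h : R) (c : 'I_s -> R)
    (y : 'cV[R]_(m + n)) (p : 'I_s -> 'cV[R]_(m + n)) :
  usubmx (y + h *: \sum_(j < s) c j *: p j) =
  usubmx y + h *: \sum_(j < s) c j *: usubmx (p j).
Proof.
apply/colP => i; rewrite !mxE !summxE; congr (_ + _ * _).
by apply: eq_bigr => j _; rewrite !mxE.
Qed.

Lemma dsubmx_increment (R : realType) (m n s : nat) (h : R) (c : 'I_s -> R)
    (y : 'cV[R]_(m + n)) (p : 'I_s -> 'cV[R]_(m + n)) :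
  dsubmx (y + h *: \sum_(j < s) c j *: p j) =
  dsubmx y + h *: \sum_(j < s) c j *: dsubmx (p j).
Proof.
apply/colP => i; rewrite !mxE !summxE; congr (_ + _ * _).
by apply: eq_bigr => j _; rewrite !mxE.
Qed.

(** A stage of the variational system is a stage of [f] together with a stage
    of the scheme for [f] linearized along it; the right-hand side is exactly
    what [rk_stages_derive] produces for [f]. *)
Lemma rk_stages_variational (R : realType) (d s : nat) (h : R)
    (a : 'I_s -> 'I_s -> R) (f : 'cV[R]_d -> 'cV[R]_d)
    (y : 'cV[R]_(d + d)) (V : 'I_s -> 'cV[R]_(d + d)) :
  rk_stages h a (fun=> variational f) y V <->
  rk_stages h a (fun=> f) (usubmx y) (fun i => usubmx (V i)) /\
  rk_stages h a (fun i w => jac f (usubmx (V i)) *m w)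
    (dsubmx y) (fun i => dsubmx (V i)).
Proof.
split=> [st|[stu std] i].
  split=> i; rewrite [in LHS](st i) ?usubmx_increment ?dsubmx_increment;
    congr (_ + _ *: _); apply: eq_bigr => j _;
    by rewrite /variational ?col_mxKu ?col_mxKd.
rewrite -[LHS]vsubmxK -[RHS]vsubmxK usubmx_increment dsubmx_increment.
congr col_mx; [rewrite [LHS]stu|rewrite [LHS]std];
  congr (_ + _ *: _); apply: eq_bigr => j _;
  by rewrite /variational ?col_mxKu ?col_mxKd.
Qed.

Lemma rk_update_variational (R : realType) (d s : nat) (h : R)
    (b : 'I_s -> R) (f : 'cV[R]_d -> 'cV[R]_d)
    (y y' : 'cV[R]_(d + d)) (V : 'I_s -> 'cV[R]_(d + d)) :
  rk_update h b (fun=> variational f) y V y' ->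
  rk_update h b (fun=> f) (usubmx y) (fun i => usubmx (V i)) (usubmx y') /\
  rk_update h b (fun i w => jac f (usubmx (V i)) *m w)
    (dsubmx y) (fun i => dsubmx (V i)) (dsubmx y').
Proof.
move=> up; split; rewrite /rk_update [in LHS]up;
  rewrite ?usubmx_increment ?dsubmx_increment;
  congr (_ + _ *: _); apply: eq_bigr => j _;
  by rewrite /variational ?col_mxKu ?col_mxKd.
Qed.

Lemma differentiable_variational (R : realType) (d : nat)
    (f : 'cV[R]_d -> 'cV[R]_d) (y : 'cV[R]_(d + d)) :
  class_C 2 setT f -> differentiable (variational f) y.
Proof.
move=> [df d2f].
have du z : differentiable (fun t : 'cV[R]_(d + d) => usubmx t) z.
  exact: (@differentiable_usubmx _ _ _ _ id).
have dd z : differentiable (fun t : 'cV[R]_(d + d) => dsubmx t) z.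
  exact: (@differentiable_dsubmx _ _ _ _ id).
apply: differentiable_col_mx.
  by apply: (@differentiable_comp _ _ _ _ usubmx f) => //; exact: df.
apply: differentiable_mx => i k; rewrite [k]ord1.
under eq_fun do rewrite mxE.
apply: differentiable_sumr => j.
apply: differentiableM; last exact: differentiable_entry.
rewrite (_ : (fun t => _) =
    fun t : 'cV[R]_(d + d) => partial j f (usubmx t) i 0); last first.
  by apply/funext => t; rewrite mxE /partial derive_entry //; exact: df.
apply: differentiable_entry.
apply: (@differentiable_comp _ _ _ _ usubmx (partial j f)) => //.
by have [+ _] := d2f j; exact.
Qed.

(** The derivative of the cost in the direction of the tangent vector carried
    by the delta-block. *)
Definition tangent_cost (R : realType) (d : nat) (C : 'cV[R]_d -> R)
    (w : 'cV[R]_(d + d)) : R :=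
  \sum_(j < d) partial j C (usubmx w) * dsubmx w j 0.

(** The final state of the adjoint scheme is the gradient of [tangent_cost].
    Its i-th x-derivative is the sum over j of [partial i (partial j C)] times
    the j-th entry of delta, which is row i of [hess C] applied to delta. *)
Lemma derive_tangent_cost (R : realType) (d : nat) (C : 'cV[R]_d -> R)
    (w v : 'cV[R]_(d + d)) :
  (forall j, differentiable (partial j C) (usubmx w)) ->
  'D_v (tangent_cost C) w =
  dot (col_mx (hess C (usubmx w) *m dsubmx w) (grad C (usubmx w))) v.
Proof.
move=> dC.
have du : differentiable (fun t : 'cV[R]_(d + d) => usubmx t) w.
  exact: (@differentiable_usubmx _ _ _ _ id).
have dd : differentiable (fun t : 'cV[R]_(d + d) => dsubmx t) w.
  exact: (@differentiable_dsubmx _ _ _ _ id).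
have dpC j : differentiable (fun t => partial j C (usubmx t)) w.
  exact: (@differentiable_comp _ _ _ _ usubmx (partial j C)).
have ddj j : differentiable (fun t : 'cV[R]_(d + d) => dsubmx t j 0 : R) w.
  exact: differentiable_entry.
have Du : 'D_v (fun t : 'cV[R]_(d + d) => usubmx t) w = usubmx v.
  by rewrite (@derive_usubmx _ _ _ _ id) // derive_id.
have Dd j : 'D_v (fun t : 'cV[R]_(d + d) => dsubmx t j 0 : R) w = dsubmx v j 0.
  rewrite (@derive_entry _ _ _ _ (fun t : 'cV[R]_(d + d) => dsubmx t)) //.
  by rewrite (@derive_dsubmx _ _ _ _ id) // derive_id.
have DpC j : 'D_v (fun t => partial j C (usubmx t)) w =
    'D_(usubmx v) (partial j C) (usubmx w).
  by rewrite -Du; exact: (derive_chain v du (dC j)).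
rewrite /tangent_cost derive_sumr; last by move=> j; exact: differentiableM.
transitivity (\sum_j (partial j C (usubmx w) * dsubmx v j 0
                       + dsubmx w j 0 * 'D_(usubmx v) (partial j C) (usubmx w))).
  apply: eq_bigr => j _.
  rewrite deriveM; [|exact: diff_derivable..].
  by rewrite DpC Dd.
rewrite big_split /= addrC /dot -[v in RHS]vsubmxK tr_col_mx mul_row_col.
rewrite [RHS]mxE; congr (_ + _); last first.
  by rewrite mxE; apply: eq_bigr => j _; rewrite !mxE.
under eq_bigr do rewrite derive_sum_partial // mulr_sumr.
rewrite exchange_big [RHS]mxE; apply: eq_bigr => i _.
rewrite 2![in RHS]mxE mulr_suml; apply: eq_bigr => j _.
by rewrite [hess _ _ _ _]mxE mulrC [_ *: _]mulrC mulrAC.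
Qed.

Lemma differentiable_tangent_cost (R : realType) (d : nat) (C : 'cV[R]_d -> R)
    (w : 'cV[R]_(d + d)) :
  (forall j, differentiable (partial j C) (usubmx w)) ->
  differentiable (tangent_cost C) w.
Proof.
move=> dC; apply: differentiable_sumr => j; apply: differentiableM.
  apply: (@differentiable_comp _ _ _ _ usubmx (partial j C)) => //.
  exact: (@differentiable_usubmx _ _ _ _ id).
apply: differentiable_entry; exact: (@differentiable_dsubmx _ _ _ _ id).
Qed.

(** * The numerical flow and its adjoint *)

Section numerical_flow.
Variables (R : realType) (d s N : nat) (h : R)
  (a : 'I_s -> 'I_s -> R) (b : 'I_s -> R) (f : 'cV[R]_d -> 'cV[R]_d)
  (y : nat -> 'cV[R]_(d + d) -> 'cV[R]_(d + d))
  (Y : nat -> 'I_s -> 'cV[R]_(d + d) -> 'cV[R]_(d + d))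
  (U : set 'cV[R]_d).
Hypotheses (f_C2 : class_C 2 setT f) (U_open : open U)
  (wd : well_defined N h a b f y Y U).

Lemma near_usubmx (z : 'cV[R]_(d + d)) :
  U (usubmx z) -> \near z, U (usubmx z).
Proof.
move=> Uz; have : {for z, continuous (usubmx : 'cV[R]_(d + d) -> 'cV[R]_d)}.
  apply: differentiable_continuous.
  exact: (@differentiable_usubmx _ _ _ _ id).
by apply; exact: open_nbhs_nbhs.
Qed.

Lemma smooth_blocks_differentiable (F : 'cV[R]_(d + d) -> 'cV[R]_(d + d))
    (z : 'cV[R]_(d + d)) :
  smooth_blocks [set z | U (usubmx z)] F -> U (usubmx z) -> differentiable F z.
Proof.
move=> [[du _] [dd _]] Uz.
rewrite (_ : F = fun t => col_mx (usubmx (F t)) (dsubmx (F t))); last first.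
  by apply/funext => t; rewrite vsubmxK.
by apply: differentiable_col_mx; [exact: du|exact: dd].
Qed.

Lemma differentiable_flow (n : nat) (z : 'cV[R]_(d + d)) :
  (n <= N)%N -> U (usubmx z) -> differentiable (y n) z.
Proof.
by case: wd => _ _ sy _ nN; apply: smooth_blocks_differentiable; exact: sy.
Qed.

Lemma differentiable_stage (n : nat) (i : 'I_s) (z : 'cV[R]_(d + d)) :
  (n < N)%N -> U (usubmx z) -> differentiable (Y n i) z.
Proof.
by case: wd => _ _ _ sY nN; apply: smooth_blocks_differentiable; exact: sY.
Qed.

Lemma derive_flow0 (z v : 'cV[R]_(d + d)) : U (usubmx z) -> 'D_v (y 0) z = v.
Proof.
case: wd => sol _ _ _ Uz; rewrite (@near_eq_derive _ _ _ _ id) ?derive_id //.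
by apply: filterS (near_usubmx Uz) => t /sol [].
Qed.

(** The delta-block of the numerical solution is the derivative of the x-block
    in the direction of the initial delta.  The derivatives of the x-stages
    solve the stage equations of the delta-block, and unique solvability of
    the coupled stage equations identifies them with the delta-stages. *)
Lemma derive_usubmx_flow (n : nat) (z : 'cV[R]_(d + d)) :
  (n <= N)%N -> U (usubmx z) ->
  'D_(col_mx (dsubmx z) 0) (fun t => usubmx (y n t)) z = dsubmx (y n z).
Proof.
move=> nN Uz; have [sol uniq _ _] := wd.
elim: n nN => [nN|n IHn nN].
  rewrite derive_usubmx; last exact: differentiable_flow.
  by rewrite derive_flow0 // col_mxKu; have [-> _] := sol _ Uz.
pose v : 'cV[R]_(d + d) := col_mx (dsubmx z) 0.
have Uz' := near_usubmx Uz.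
have dy : differentiable (fun t => usubmx (y n t)) z.
  by apply: differentiable_usubmx; exact: differentiable_flow (ltnW nN) Uz.
have dY i : differentiable (fun t => usubmx (Y n i t)) z.
  by apply: differentiable_usubmx; exact: differentiable_stage.
have df t : differentiable f t by have [df _] := f_C2; exact: df.
have st : rk_stages h a (fun i w => jac f (usubmx (Y n i z)) *m w)
    (dsubmx (y n z)) (fun i => 'D_v (fun t => usubmx (Y n i t)) z).
  rewrite -(IHn (ltnW nN)).
  apply: (@rk_stages_derive _ _ _ _ _ _ f _ (fun i t => usubmx (Y n i t))) => //.
  apply: filterS Uz' => t /sol [_ /(_ n nN) [stt _]].
  by have /rk_stages_variational [] := stt.
have YE i : 'D_v (fun t => usubmx (Y n i t)) z = dsubmx (Y n i z).
  (* The candidate keeps the x-stages and replaces the delta-stages. *)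
  rewrite -(uniq z Uz n nN (fun i => col_mx (usubmx (Y n i z))
    ('D_v (fun t => usubmx (Y n i t)) z))) ?col_mxKd //.
  apply/rk_stages_variational; split.
    have [_ /(_ n nN) [/rk_stages_variational [stu _] _]] := sol _ Uz.
    move=> k; rewrite col_mxKu [LHS]stu; congr (_ + _ *: _).
    by apply: eq_bigr => j _; rewrite col_mxKu.
  by move=> k; rewrite col_mxKd st; congr (_ + _ *: _); apply: eq_bigr => j _;
    rewrite col_mxKu col_mxKd.
have up := @rk_update_derive _ _ _ _ h b f (fun t => usubmx (y n t))
  (fun t => usubmx (y n.+1 t)) (fun i t => usubmx (Y n i t)) z v.
rewrite up //; last first.
  apply: filterS Uz' => t /sol [_ /(_ n nN) [_ upt]].
  by have [] := rk_update_variational upt.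
have [_ /(_ n nN) [_ /rk_update_variational [_ ->]]] := sol _ Uz.
rewrite (IHn (ltnW nN)); congr (_ + _ *: _); apply: eq_bigr => j _.
by rewrite YE.
Qed.

(** The product of the adjoint state with the derivative of the flow is the same
    at every step, and the derivative of y_0 is the identity. *)
Lemma dot_adjoint_flow (A : 'I_s -> 'I_s -> R) (B : 'I_s -> R)
    (phi : nat -> 'cV[R]_(d + d)) (Phi : nat -> 'I_s -> 'cV[R]_(d + d))
    (z v : 'cV[R]_(d + d)) :
  (forall i, b i = B i) ->
  (forall i j, b i * A i j + B j * a j i = b i * B j) ->
  adjoint_solution N h A B (variational f) (fun n i => Y n i z) phi Phi ->
  U (usubmx z) ->
  dot (phi 0%N) v = dot (phi N) ('D_v (y N) z).
Proof.
move=> bB abAB adj Uz; have [sol _ _ _] := wd.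
rewrite -[v in LHS](derive_flow0 v Uz).
suff inv n : (n <= N)%N ->
    dot (phi n) ('D_v (y n) z) = dot (phi 0%N) ('D_v (y 0%N) z).
  by rewrite inv.
elim: n => [//|n IHn nN]; rewrite -(IHn (ltnW nN)).
have [stP upP] := adj n nN.
have Uz' := near_usubmx Uz.
have dy : differentiable (y n) z by exact: differentiable_flow (ltnW nN) Uz.
have dY i : differentiable (Y n i) z by exact: differentiable_stage.
have dg i : differentiable (variational f) (Y n i z).
  exact: differentiable_variational.
apply: (rk_bilinear_invariant bB abAB _ _ stP upP).
- apply: rk_stages_derive => //.
  by apply: filterS Uz' => t /sol [_ /(_ n nN) []].
- apply: rk_update_derive => //.
  by apply: filterS Uz' => t /sol [_ /(_ n nN) []].
Qed.

Lemma near_open (th : 'cV[R]_d) : U th -> \near th, U th.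
Proof. by move=> Uth; exact: open_nbhs_nbhs. Qed.

Lemma differentiable_slice (n : nat) (th ga : 'cV[R]_d) :
  (n <= N)%N -> U th -> differentiable (fun t => y n (col_mx t ga)) th.
Proof.
move=> nN Uth.
apply: (@differentiable_comp _ _ _ _ (fun t => col_mx t ga) (y n)).
  exact: differentiable_col_mx.
by apply: differentiable_flow; rewrite ?col_mxKu.
Qed.

Section cost.
Variables (C : 'cV[R]_d -> R) (x : 'cV[R]_d -> 'cV[R]_d).
Hypotheses (dC : forall t, differentiable C t)
  (xE : forall th ga, U th -> usubmx (y N (col_mx th ga)) = x th).

(** [x] agrees with the x-block of the flow on [U] only, so derivatives of the
    cost are computed through the flow near points of [U].  The x-block
    does not depend on the initial delta, so [ga] can be chosen to match the
    direction of differentiation. *)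
Lemma derive_cost (th ga v : 'cV[R]_d) : U th ->
  'D_v (fun t => C (x t)) th =
  'D_v (fun t => C (usubmx (y N (col_mx t ga)))) th.
Proof.
move=> Uth; apply: near_eq_derive.
by apply: filterS (near_open Uth) => t /xE ->.
Qed.

(** Being the derivative of the cost in the direction [ga] by
    [derive_usubmx_flow] and the chain rule, the left-hand side is linear in
    [ga]. *)
Lemma tangent_cost_flow (th ga : 'cV[R]_d) : U th ->
  tangent_cost C (y N (col_mx th ga)) = dot (grad (fun t => C (x t)) th) ga.
Proof.
move=> Uth.
have dy w : differentiable (fun t => usubmx (y N (col_mx t w))) th.
  by apply: differentiable_usubmx; exact: differentiable_slice.
transitivity ('D_ga (fun t => C (x t)) th).
  rewrite (derive_cost ga ga Uth).
  rewrite (@derive_chain _ _ _ _ (fun t => usubmx (y N (col_mx t ga))) C) //.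
  rewrite -(derive_slice_usubmx (fun z => usubmx (y N z))).
  rewrite -[ga in col_mx ga 0](col_mxKd th ga) derive_usubmx_flow ?col_mxKu //.
  rewrite derive_sum_partial //.
  by apply: eq_bigr => j _; rewrite mulrC.
rewrite (derive_cost 0 ga Uth) -dot_grad; last first.
  exact: (@differentiable_comp _ _ _ _ (fun t => usubmx (y N (col_mx t 0))) C).
congr (dot _ _); apply/colP => i; rewrite !mxE /partial.
by rewrite (derive_cost 0 _ Uth).
Qed.

End cost.

End numerical_flow.

(** * The gradient and the Hessian of the discrete cost *)

Unset Implicit Arguments.
Set Strict Implicit.

Theorem theorem2 (R : realType) (d N s : nat)
  (f : 'cV[R]_d -> 'cV[R]_d) (C : 'cV[R]_d -> R)
  (theta gamma : 'cV[R]_d) (h : R)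
  (a A : 'I_s -> 'I_s -> R) (b B : 'I_s -> R)
  (U : set 'cV[R]_d)
  (y : nat -> 'cV[R]_(d + d) -> 'cV[R]_(d + d))
  (Y : nat -> 'I_s -> 'cV[R]_(d + d) -> 'cV[R]_(d + d))
  (x : nat -> 'cV[R]_d -> 'cV[R]_d)
  (delta : nat -> 'cV[R]_d -> 'cV[R]_d -> 'cV[R]_d)
  (xi lambda : nat -> 'cV[R]_d)
  (Phi : nat -> 'I_s -> 'cV[R]_(d + d))
  (f_C2 : class_C 2 setT f)
  (C_diff2 : twice_differentiable C)
  (h_gt0 : 0 < h) (N_ge1 : (1 <= N)%N) (s_ge1 : (1 <= s)%N)
  (b_neq0 : forall i, b i != 0)
  (U_theta : open_nbhs theta U)
  (y_wd : well_defined N h a b f y Y U)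
  (y_blocks : forall n th ga, (n <= N)%N -> U th ->
     y n (col_mx th ga) = col_mx (x n th) (delta n th ga))
  (bB : forall i, b i = B i)
  (abAB : forall i j, b i * A i j + B j * a j i = b i * B j)
  (adj : adjoint_solution N h A B (variational f)
     (fun n i => Y n i (col_mx theta gamma))
     (fun n => col_mx (xi n) (lambda n)) Phi)
  (xi_N : xi N = hess C (x N theta) *m delta N theta gamma)
  (lambda_N : lambda N = grad C (x N theta)) :
  xi 0%N = hess (fun th => C (x N th)) theta *m gamma /\
  lambda 0%N = grad (fun th => C (x N th)) theta.
Proof.
have [_ Ut] := U_theta; have U_open := U_theta.1; have [dC d2C] := C_diff2.
pose z0 := col_mx theta gamma.
pose G z := tangent_cost C (y N z).
have xE th ga : U th -> usubmx (y N (col_mx th ga)) = x N th.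
  by move=> Uth; rewrite y_blocks // col_mxKu.
have GE := tangent_cost_flow f_C2 U_open y_wd dC xE.
have dG ga : differentiable (fun t => G (col_mx t ga)) theta.
  apply: (@differentiable_comp _ _ _ _ (fun t => y N (col_mx t ga))
    (tangent_cost C)); first exact: (differentiable_slice y_wd).
  by apply: differentiable_tangent_cost => j; exact: d2C.
(* phi_0 is the gradient of G at (theta, gamma). *)
have phi0 v : dot (col_mx (xi 0%N) (lambda 0%N)) v = 'D_v G z0.
  have Uz : U (usubmx z0) by rewrite col_mxKu.
  rewrite (dot_adjoint_flow f_C2 U_open y_wd v bB abAB adj Uz).
  rewrite /G (@derive_chain _ _ _ _ (y N) (tangent_cost C)).
  - rewrite derive_tangent_cost; last by move=> j; exact: d2C.
    by rewrite xi_N lambda_N y_blocks // col_mxKu col_mxKd.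
  - exact: (differentiable_flow y_wd).
  - by apply: differentiable_tangent_cost => j; exact: d2C.
have GEe th j : U th -> G (col_mx th (delta_mx j 0)) =
    partial j (fun t => C (x N t)) th.
  by move=> Uth; rewrite /G GE // dot_delta mxE.
split; apply/colP => i.
  rewrite -[LHS](col_mxEu _ (lambda 0%N)) -dot_delta phi0 delta_mx_ushift.
  rewrite derive_slice_usubmx.
  (* G is linear in gamma, so its theta-derivative is a combination of those
     at the basis vectors, where G is a partial derivative of the cost. *)
  rewrite (@near_eq_derive _ _ _ _
    (fun t => \sum_j gamma j 0 *: G (col_mx t (delta_mx j 0)))); last first.
    apply: filterS (near_open U_open Ut) => t Utt.
    rewrite /G GE // /dot mxE; apply: eq_bigr => j _.
    by rewrite -/(G _) GEe // !mxE mulrC.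
  rewrite derive_sumr; last by move=> j; exact: differentiableZ.
  rewrite mxE; apply: eq_bigr => j _.
  rewrite deriveZ; last exact: diff_derivable.
  rewrite mxE mulrC; congr (_ * _); apply: near_eq_derive.
  by apply: filterS (near_open U_open Ut) => t; exact: GEe.
rewrite -[LHS](col_mxEd (xi 0%N)) -dot_delta phi0 delta_mx_dshift.
rewrite derive_slice_dsubmx.
have -> : (fun t => G (col_mx theta t)) =
    dot (grad (fun t => C (x N t)) theta).
  by apply/funext => t; rewrite /G GE.
by rewrite derive_dot dot_delta.
Qed.
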